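(* Let $G=(V,E)$ be a finite directed graph, $d\ge 1$, let $p_1,\dots,p_d$ be topic influence probability functions on $G$, let $1\le k\le |V|$, and let $\Lambda$ be a landmark set. Let $I=(\lambda_1,\dots,\lambda_d)$ be an item with each $\lambda_i\in\Lambda$, and let $p=\sum_{i\in[d]}\lambda_ip_i$. Suppose that the greedy seed sets $S^g(k,\lambda_1p_1),\dots,S^g(k,\lambda_dp_d)$ are pairwise disjoint, and that $S^g(k,\lambda_ip_i)\subseteq \nu_i(0)$ for every $i$ with $\lambda_i>0$. If the network is fully separable for all topics, then the seed set returned by the Marginal Influence Sort (MIS) algorithm on $I$ is one of the possible outputs of the greedy algorithm under the mixed influence probability function $p$; that is, its elements can be ordered as $v_1,\dots,v_k$ so that, with $S_0=\emptyset$ and $S_\ell=S_{\ell-1}\cup\{v_\ell\}$, $$v_\ell\in\arg\max_{v\in V\setminus S_{\ell-1}}MI(v\mid S_{\ell-1},p)\qquad\text{for all }\ell=1,\dots,k.$$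
   Context: **Independent cascade model.** $G=(V,E)$ is a finite directed graph. An influence probability function is $q:V\times V\to[0,1]$ with $q(u,v)=0$ whenever $(u,v)\notin E$ or $u=v$. Given a seed set $S\subseteq V$, the nodes of $S$ are active at time $0$. At each time $t\ge1$, every node $u$ that became active at time $t-1$ has one chance to activate each currently inactive out-neighbor $v$, succeeding independently with probability $q(u,v)$. Active nodes stay active, and the process stops when no new node is activated. The influence spread $\sigma(S,q)$ is the expected number of active nodes at the end. The marginal influence is $MI(v\mid S,q)=\sigma(S\cup\{v\},q)-\sigma(S,q)$. **Topics and items.** $[d]=\{1,\dots,d\}$. For each topic $i\in[d]$, $p_i$ is an influence probability function. An item (topic mixture) is a vector $I=(\lambda_1,\dots,\lambda_d)$ with $\lambda_i\in[0,1]$ and $\sum_i\lambda_i=1$; its influence probability function is $p=\sum_{i\in[d]}\lambda_ip_i$. **Full separability.** For topic $i$ let $\nu_i(0)=\{v\in V : \sum_{u:(v,u)\in E}p_i(v,u)+\sum_{u:(u,v)\in E}p_i(u,v)>0\}$, the set of nodes incident to some edge with positive probability on topic $i$. The network is fully separable for all topics if $\nu_i(0)\cap\nu_j(0)=\emptyset$ for all $i\ne j$. **Greedy algorithm.** For an influence probability function $q$: $S_0=\emptyset$; for $j=1,\dots,k$ pick $v_j\in\arg\max_{v\in V\setminus S_{j-1}}MI(v\mid S_{j-1},q)$ (ties broken arbitrarily, marginal influences computed exactly) and set $S_j=S_{j-1}\cup\{v_j\}$. The output is $S^g(k,q)=S_k$. For each function $q=\lambda p_i$ with $\lambda\in\Lambda$,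 one greedy run is fixed; for that run put $MI^g(v_j,q)=MI(v_j\mid S_{j-1},q)$ for the selected nodes $v_j$, and $MI^g(v,q)=0$ for $v\notin S^g(k,q)$. **Landmarks.** A landmark set is a finite set $\Lambda=\{\lambda^c_0,\dots,\lambda^c_m\}$ with $0=\lambda^c_0<\cdots<\lambda^c_m=1$. For $\lambda\in[0,1]$, $\underline{\lambda}$ is the largest element of $\Lambda$ that is $\le\lambda$. **MIS algorithm.** The sets $S^g(k,\lambda p_i)$ and values $MI^g(v,\lambda p_i)$ are precomputed for all $\lambda\in\Lambda$, $i\in[d]$. Given an item $I$, let $V^g=\bigcup_{i\in[d],\,\underline{\lambda_i}>0}S^g(k,\underline{\lambda_i}p_i)$, and for $v\in V^g$ let $f(v)=\sum_{i\in[d],\,\underline{\lambda_i}>0}MI^g(v,\underline{\lambda_i}p_i)$. Return $k$ nodes of $V^g$ with the largest values of $f$ (ties broken arbitrarily). *)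

(* Defs.v *)
From HB Require Import structures.
From mathcomp Require Import all_boot all_order all_algebra.
Set Implicit Arguments.
Unset Strict Implicit.
Unset Printing Implicit Defensive.
Import Order.TTheory GRing.Theory Num.Theory.
Local Open Scope ring_scope.

Section IndependentCascade.

Variables (R : realFieldType) (V : finType) (E : rel V).
Implicit Types (q : V -> V -> R) (S A F : {set V}) (B C : {set V * V}).

Definition influence_prob q : Prop :=
  (forall u v, 0 <= q u v <= 1) /\
  (forall u v, ~~ E u v || (u == v) -> q u v = 0).

(* A state of the cascade is a pair (A, F): A is the set of active nodes and
   F \subset A the set of those activated in the last step. *)
Definition attempts A F : {set V * V} :=
  [set e | [&& e.1 \in F, e.2 \notin A & E e.1 e.2]].

(* The probability that B is exactly the set of successful attempts, when the
   attempts in C succeed independently of each other (B \subset C). *)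
Definition outcome_prob q C B : R :=
  (\prod_(e in B) q e.1 e.2) * (\prod_(e in C :\: B) (1 - q e.1 e.2)).

Definition activated B : {set V} := [set e.2 | e in B].

(* The expected number of active nodes t steps after the state (A, F). *)
Fixpoint expected_active q (t : nat) A F : R :=
  if t is t'.+1 then
    \sum_(B in powerset (attempts A F))
      outcome_prob q (attempts A F) B *
      expected_active q t' (A :|: activated B) (activated B)
  else #|A|%:R.

(* The set of active nodes grows at every step until the process stops, so the
   process has stopped after #|V| steps. *)
Definition spread q S : R := expected_active q #|V| S S.

Definition marginal q (v : V) S : R := spread q (v |: S) - spread q S.

(* s lists the nodes v_1, ..., v_k in the order of their selection, so that
   S_j = [set x in take j s]. *)
Definition greedy_run q (k : nat) (s : k.-tuple V) : Prop :=
  forall j : 'I_k,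
    let Sj := [set x in take j s] in
    tnth s j \notin Sj /\
    (forall v, v \notin Sj -> marginal q v Sj <= marginal q (tnth s j) Sj).

Definition greedy_marginal q (k : nat) (s : k.-tuple V) (v : V) : R :=
  if v \in s then marginal q v [set x in take (index v s) s] else 0.

(* The set written \nu_i(0) when q = p_i. *)
Definition topic_nodes q : {set V} :=
  [set v | 0 < \sum_(u | E v u) q v u + \sum_(u | E u v) q u v].

End IndependentCascade.

Section Topics.

Variables (R : realFieldType) (V : finType) (E : rel V) (d : nat).
Implicit Types (p : 'I_d -> V -> V -> R) (lam : 'I_d -> R) (L : seq R).

Definition item lam : Prop :=
  (forall i, 0 <= lam i <= 1) /\ \sum_i lam i = 1.

Definition scale (a : R) (q : V -> V -> R) : V -> V -> R :=
  fun u v => a * q u v.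

Definition mixture lam p : V -> V -> R :=
  fun u v => \sum_i lam i * p i u v.

Definition fully_separable p : Prop :=
  forall i j, i != j -> [disjoint topic_nodes E (p i) & topic_nodes E (p j)].

(* The defaults of head and last make both equations fail for L = [::]. *)
Definition landmarks L : Prop :=
  [/\ sorted <%R L, head 1 L = 0 & last 0 L = 1].

(* The largest landmark at most x, for x >= 0; the default 0 is a landmark. *)
Definition lower_landmark L (x : R) : R := \big[Num.max/0]_(y <- L | y <= x) y.

Section MIS.

(* run a i is the greedy run fixed for the function a p_i, for a landmark a. *)
Variables (p : 'I_d -> V -> V -> R) (L : seq R) (k : nat).
Variables (run : R -> 'I_d -> k.-tuple V) (lam : 'I_d -> R).

Definition seeds (a : R) (i : 'I_d) : {set V} := [set x in run a i].

Definition mis_candidates : {set V} :=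
  \bigcup_(i | 0 < lower_landmark L (lam i))
    seeds (lower_landmark L (lam i)) i.

Definition mis_score (v : V) : R :=
  \sum_(i | 0 < lower_landmark L (lam i))
    greedy_marginal E (scale (lower_landmark L (lam i)) (p i))
      (run (lower_landmark L (lam i)) i) v.

Definition mis_output (T : {set V}) : Prop :=
  [/\ T \subset mis_candidates, #|T| = k &
      forall u w, u \in T -> w \in mis_candidates :\: T ->
        mis_score w <= mis_score u].

End MIS.

End Topics.

(* Main.v *)
(* In the live-edge description of the cascade, in which every edge is kept
   independently with its influence probability, MI(v | S, q) is the expected
   number of nodes reachable from v but not from S.  Hence marginal influences
   are submodular, and for v in nu_i(0) separability gives
   MI(v | S, p) = MI(v | S :&: nu_i(0), lam_i p_i), while a node in no nu_i(0)
   with lam_i > 0 has marginal influence 1.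

   Order the MIS output by decreasing score, breaking ties by the position in
   the topic's greedy run.  By submodularity scores decrease along each run, so
   the nodes of nu_i(0) chosen before v_l precede it in the run of topic i, and
   MI(v_l | S_(l-1), p) is at least the score of v_l.  Conversely, for a further
   node w of nu_j(0), let x be the first node of the run of topic j outside
   S_(l-1): then MI(w | S_(l-1), p) is at most the score of x, which is at most
   that of v_l. *)
Require Import Defs.
From HB Require Import structures.
From mathcomp Require Import all_boot all_order all_algebra.
Set Implicit Arguments.
Unset Strict Implicit.
Unset Printing Implicit Defensive.
Import Order.TTheory GRing.Theory Num.Theory.
Local Open Scope ring_scope.

(** * Independent outcomes of edges and expectations over live-edge sets *)

Section LiveEdge.

Variables (R : realFieldType) (V : finType) (E : rel V).
Implicit Types (q : V -> V -> R) (S A F N : {set V}) (B C D X Y : {set V * V}).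
Implicit Types (g : {set V * V} -> R).

Lemma outcome_prob_setU q C D B1 B2 :
    [disjoint C & D] -> B1 \subset C -> B2 \subset D ->
  outcome_prob q (C :|: D) (B1 :|: B2) =
  outcome_prob q C B1 * outcome_prob q D B2.
Proof.
move=> dCD sB1 sB2; rewrite /outcome_prob mulrACA.
have dB : [disjoint B1 & B2] := disjointW sB1 sB2 dCD.
rewrite (eq_bigl [predU B1 & B2]); last by move=> e; rewrite !inE.
rewrite bigU //=; congr (_ * _).
have -> : (C :|: D) :\: (B1 :|: B2) = (C :\: B1) :|: (D :\: B2).
  apply/setP=> e; rewrite !inE.
  have /implyP := subsetP sB1 e; have /implyP := subsetP sB2 e.
  have : ~~ ((e \in C) && (e \in D)).
    by apply/negP=> /andP[eC]; rewrite (disjointFr dCD eC).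
  by case: (e \in C); case: (e \in D); case: (e \in B1); case: (e \in B2).
rewrite (eq_bigl [predU C :\: B1 & D :\: B2]); last by move=> e; rewrite !inE.
by rewrite bigU //; apply: disjointW dCD; apply: subsetDl.
Qed.

Lemma sum_outcome_prob q C :
  \sum_(B in powerset C) outcome_prob q C B = 1.
Proof.
(* Expand a product of factors [F e + G e], all equal to 1: there is one term per set [B], and it
   vanishes unless [B] lies in [C]. *)
pose F e := if e \in C then q e.1 e.2 else 0.
pose G e := if e \in C then 1 - q e.1 e.2 else 1.
transitivity (\prod_e (F e + G e)); last first.
  apply: big1 => e _; rewrite /F /G; case: ifP => _; last by rewrite add0r.
  by rewrite addrC subrK.
rewrite bigA_distr [RHS](bigID [in powerset C]) /= [X in _ + X]big1 ?addr0.
  apply: eq_big => [B|B]; rewrite ?inE // => sBC; rewrite /outcome_prob.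
  rewrite [RHS](bigID [in B]) /=; congr (_ * _).
    by apply: eq_bigr => e eB; rewrite eB /F (subsetP sBC).
  rewrite (big_mkcond [in C :\: B]) [RHS]big_mkcond; apply: eq_bigr => e _.
  by rewrite !inE /G; case: (e \in B).
move=> B; rewrite inE => /subsetPn[e eB eC].
by rewrite (bigD1 e) //= eB /F (negPf eC) mul0r.
Qed.

Lemma outcome_prob_ge0 q C B :
  (forall u v, 0 <= q u v <= 1) -> 0 <= outcome_prob q C B.
Proof.
move=> q01; apply: mulr_ge0; apply: prodr_ge0 => e _.
  by case/andP: (q01 e.1 e.2).
by rewrite subr_ge0; case/andP: (q01 e.1 e.2).
Qed.

(* The set X of live edges contains each pair e independently with probability
   q e.1 e.2; pairs outside E are ignored by [reach_step] below. *)
Definition expectation q g : R := \sum_X outcome_prob q setT X * g X.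

(** A live-edge set is determined by its traces on [C] and [~: C], which are independent. *)
Lemma expectation_split q C g :
  expectation q g =
  \sum_(B1 in powerset C) \sum_(B2 in powerset (~: C))
    outcome_prob q C B1 * outcome_prob q (~: C) B2 * g (B1 :|: B2).
Proof.
rewrite /expectation pair_big_dep /=.
rewrite (reindex_onto (fun B : {set V * V} * {set V * V} => B.1 :|: B.2)
   (fun X : {set V * V} => (X :&: C, X :&: ~: C))) /=; last first.
  by move=> X _; rewrite -setIUr setUCr setIT.
apply: eq_big => [[B1 B2]|[B1 B2] /eqP] /=.
  rewrite !inE xpair_eqE; apply/idP/idP.
    by move=> /andP[/eqP <- /eqP <-]; rewrite !subsetIr.
  move=> /andP[s1 s2]; rewrite !setIUl.
  rewrite (setIidPl s1) (setIidPl s2).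
  have /setIidPl s1' := s1; have /setIidPl s2' := s2.
  have -> : B2 :&: C = set0.
    by apply/eqP; rewrite setI_eq0 disjoints_subset.
  have -> : B1 :&: ~: C = set0 by apply/eqP; rewrite -setDE setD_eq0.
  by rewrite setU0 set0U !eqxx.
case=> e1 e2; rewrite -[X in outcome_prob _ X _](setUCr C) outcome_prob_setU //.
- by rewrite -setI_eq0 setICr.
- by rewrite -e1 subsetIr.
- by rewrite -e2 subsetIr.
Qed.

Lemma expectation_local q C g :
  (forall X, g X = g (X :&: C)) ->
  expectation q g = \sum_(B in powerset C) outcome_prob q C B * g B.
Proof.
move=> gC; rewrite (expectation_split q C); apply: eq_bigr => B.
rewrite inE => sB; rewrite -[RHS]mulr1 -(sum_outcome_prob q (~: C)) mulr_sumr.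
apply: eq_bigr => B2; rewrite inE => sB2; rewrite gC setIUl (setIidPl sB).
have -> : B2 :&: C = set0 by apply/eqP; rewrite setI_eq0 disjoints_subset.
by rewrite setU0 mulrAC.
Qed.

(** The trace of [X] on [C] may be replaced by an independent fresh copy [B]; one cascade step
    corresponds to one such replacement. *)
Lemma expectation_resample q C g :
  expectation q g =
  \sum_(B in powerset C) outcome_prob q C B *
    expectation q (fun X => g (B :|: X :\: C)).
Proof.
rewrite (expectation_split q C); apply: eq_bigr => B _.
rewrite (@expectation_local q (~: C)); last first.
  by move=> X; rewrite !setDE -setIA setIid.
rewrite mulr_sumr; apply: eq_bigr => B2; rewrite inE => sB2.
by rewrite mulrA setDE (setIidPl sB2).
Qed.

Lemma expectation_cst q c : expectation q (fun=> c) = c.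
Proof.
have powT : [set: {set V * V}] = powerset setT.
  by apply/setP=> B; rewrite !inE subsetT.
rewrite /expectation -mulr_suml -[RHS]mul1r; congr (_ * _).
rewrite -(sum_outcome_prob q setT); apply: eq_bigl => B.
by rewrite inE subsetT.
Qed.

(** A set containing a pair of probability 0 has weight 0, so structural properties of the live
    graph can be read off the zeros of [q]. *)
Lemma eq_expectation_support q g h :
  (forall X, (forall e, e \in X -> q e.1 e.2 != 0) -> g X = h X) ->
  expectation q g = expectation q h.
Proof.
move=> gh; apply: eq_bigr => X _.
have [Xq|] := boolP [forall e in X, q e.1 e.2 != 0].
  by rewrite gh // => e; move/forall_inP: Xq; apply.
rewrite negb_forall_in => /exists_inP[e eX]; rewrite negbK => /eqP q0.
by rewrite /outcome_prob (bigD1 e) //= q0 !mul0r.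
Qed.

Lemma expectationB q g h :
  expectation q g - expectation q h = expectation q (fun X => g X - h X).
Proof. by rewrite /expectation -sumrB; apply: eq_bigr => X _; rewrite mulrBr. Qed.

(** * Reachability along live edges and its coupling with the cascade *)

Definition reach_step X S : {set V} :=
  S :|: [set v | [exists u in S, E u v && ((u, v) \in X)]].

Definition reach X t S : {set V} := iter t (reach_step X) S.

Lemma reach_stepP X S v :
  reflect (v \in S \/ exists2 u, u \in S & E u v /\ (u, v) \in X)
          (v \in reach_step X S).
Proof.
rewrite !inE; apply: (iffP orP).
  case=> [?|/exists_inP[u uS /andP[? ?]]]; first by left.
  by right; exists u.
case=> [?|[u uS [? ?]]]; first by left.
by right; apply/exists_inP; exists u => //; apply/andP.
Qed.

Lemma reach_stepU X S1 S2 :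
  reach_step X (S1 :|: S2) = reach_step X S1 :|: reach_step X S2.
Proof.
apply/setP => v; rewrite [RHS]in_setU; apply/reach_stepP/orP.
  case=> [/setUP[vS|vS]|[u /setUP[uS|uS] Xu]];
    [left|right|left|right]; apply/reach_stepP; by [left|right; exists u].
case=> /reach_stepP[vS|[u uS Xu]].
- by left; rewrite inE vS.
- by right; exists u => //; rewrite inE uS.
- by left; rewrite inE vS orbT.
- by right; exists u => //; rewrite inE uS orbT.
Qed.

Lemma reachU X t S1 S2 : reach X t (S1 :|: S2) = reach X t S1 :|: reach X t S2.
Proof. by elim: t => //= t IH; rewrite -reach_stepU -IH. Qed.

Lemma reachS X t S1 S2 : S1 \subset S2 -> reach X t S1 \subset reach X t S2.
Proof. by move=> /setUidPr <-; rewrite reachU subsetUl. Qed.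

(** The middle term between [expected_active], which draws edges step by step, and [reach], for
    which all edges are fixed in advance. *)
Fixpoint live_cascade X t A F : nat :=
  if t is t'.+1 then
    let F' := activated (X :&: attempts E A F) in
    live_cascade X t' (A :|: F') F'
  else #|A|.

Lemma activated_live_attempts X A F v :
  reflect (v \notin A /\ exists2 u, u \in F & E u v /\ (u, v) \in X)
          (v \in activated (X :&: attempts E A F)).
Proof.
apply: (iffP imsetP) => [[[u w]]|[vA [u uF [Euv uvX]]]].
  rewrite !inE /= => /andP[uvX /and3P[uF wA Euw]] ->.
  by split=> //; exists u.
by exists (u, v) => //; rewrite !inE /= uvX uF vA Euv.
Qed.

(** No live edge from an older active node leaves [A], so expanding from [F] alone has the same
    effect as expanding from all of [A]. *)
Lemma live_cascadeE X t A F : F \subset A ->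
    (forall u v, u \in A :\: F -> E u v -> (u, v) \in X -> v \in A) ->
  live_cascade X t A F = #|reach X t A|.
Proof.
elim: t A F => //= t IH A F sFA closed.
have stepE : A :|: activated (X :&: attempts E A F) = reach_step X A.
  apply/setP=> v; rewrite in_setU; apply/orP/reach_stepP.
    case=> [|/activated_live_attempts[vA [u uF Xuv]]]; first by left.
    by right; exists u => //; apply: (subsetP sFA).
  case=> [|[u uA [Euv uvX]]]; first by left.
  have [vA|vA] := boolP (v \in A); [by left | right].
  apply/activated_live_attempts; split=> //; exists u => //.
  by apply: contraR vA => uF; apply: closed uvX => //; rewrite inE uF.
rewrite stepE IH; first by rewrite /reach -iterSr.
  by rewrite -stepE subsetUr.
move=> u v; rewrite -{1}stepE !inE => /andP[/negbTE -> /=].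
rewrite orbF => uA Euv uvX; apply/orP; right; apply/exists_inP; exists u => //.
by rewrite Euv.
Qed.

(** Nodes of [A] outside [F] have used up their attempts, so their outgoing edges are never
    inspected again. *)
Lemma eq_live_cascade X Y t A F : F \subset A ->
    (forall u v, (u \in F) || (u \notin A) -> ((u, v) \in X) = ((u, v) \in Y)) ->
  live_cascade X t A F = live_cascade Y t A F.
Proof.
elim: t A F => //= t IH A F sFA eqXY.
have -> : X :&: attempts E A F = Y :&: attempts E A F.
  apply/setP=> -[u v]; rewrite !inE /=.
  by case uF: (u \in F); rewrite ?andbF // eqXY // uF.
apply: IH; first exact: subsetUr.
move=> u v; rewrite in_setU negb_or => /orP[uF|/andP[uA _]]; apply: eqXY.
  by move: uF; case/activated_live_attempts => ->; rewrite orbT.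
by rewrite uA orbT.
Qed.

(* Deferred decisions: the attempts of one step involve edges whose sources
   never attempt again, so these edges can be resampled. *)
Lemma expected_active_live q t A F : F \subset A ->
  expected_active E q t A F = expectation q (fun X => (live_cascade X t A F)%:R).
Proof.
elim: t A F => [|t IH] A F sFA /=; first by rewrite expectation_cst.
rewrite (expectation_resample q (attempts E A F)); apply: eq_bigr => B.
rewrite inE => sB; rewrite IH ?subsetUr //; congr (_ * _); apply: eq_bigr => X _.
have -> : (B :|: X :\: attempts E A F) :&: attempts E A F = B.
  by rewrite setIUl (setIidPl sB) setIDAC setDIl setDv setI0 setU0.
congr (_ * _%:R); apply: eq_live_cascade; first exact: subsetUr.
(* Sources of later attempts lie outside [A], hence outside [F], so these edges are not among the
   resampled ones. *)
move=> u v uA; have uvC : (u, v) \notin attempts E A F.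
  rewrite !inE /= negb_and; apply/orP; left.
  have [uB|] := boolP (u \in activated B); last first.
    by move=> nB; move: uA; rewrite (negPf nB) inE negb_or /= => /andP[+ _];
       apply: contra => /(subsetP sFA).
  case/imsetP: uB => e /(subsetP sB); rewrite !inE => /and3P[_ e2A _] ->.
  by apply: contra e2A => /(subsetP sFA).
rewrite in_setU in_setD (negPf uvC) /=; case uvB: ((u, v) \in B) => //.
by move: uvC; rewrite (subsetP sB).
Qed.

(** * Marginal influence: submodularity and locality *)

Lemma spread_reach q S :
  spread E q S = expectation q (fun X => #|reach X #|V| S|%:R).
Proof.
rewrite /spread expected_active_live //; apply: eq_bigr => X _.
by rewrite live_cascadeE // => u v; rewrite setDv inE.
Qed.

Lemma marginal_reach q v S :
  marginal E q v S =
  expectation q (fun X => #|reach X #|V| [set v] :\: reach X #|V| S|%:R).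
Proof.
rewrite /marginal !spread_reach expectationB; apply: eq_bigr => X _.
set Sv := reach X _ [set v]; set SS := reach X _ S.
have -> : reach X #|V| (v |: S) = Sv :|: SS by rewrite reachU.
rewrite -(cardsID SS (Sv :|: SS)) (setIidPr (subsetUr _ _)) setDUl setDv setU0.
by rewrite natrD addrAC subrr add0r.
Qed.

(** The inequality holds for each live-edge set separately: a larger seed set removes more from what
    [v] reaches. *)
Lemma marginal_submodular q v S1 S2 :
    (forall u w, 0 <= q u w <= 1) -> S1 \subset S2 ->
  marginal E q v S2 <= marginal E q v S1.
Proof.
move=> q01 s12; rewrite !marginal_reach; apply: ler_sum => X _.
apply: ler_wpM2l; first exact: outcome_prob_ge0.
by rewrite ler_nat subset_leq_card // setDS // reachS.
Qed.

(** No pair of [X] crosses the boundary of [N] in either direction: [N] is a union of weakly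
    connected components. *)
Definition edge_closed X N : Prop :=
  forall u w, (u, w) \in X -> (u \in N) = (w \in N).

Lemma reach_setI X t S N :
  edge_closed X N -> reach X t S :&: N = reach X t (S :&: N).
Proof.
move=> XN; elim: t => //= t <-; set A := reach X t S.
apply/setP=> v; rewrite in_setI; apply/andP/reach_stepP.
  case=> /reach_stepP[vA vN|[u uA [Euv uvX]] vN]; first by left; rewrite inE vA.
  by right; exists u => //; rewrite inE uA (XN _ _ uvX).
case=> [/setIP[vA vN]|[u /setIP[uA uN] [Euv uvX]]]; split=> //.
- by apply/reach_stepP; left.
- by apply/reach_stepP; right; exists u.
- by rewrite -(XN _ _ uvX).
Qed.

Lemma reach_sub X t S N : edge_closed X N -> S \subset N -> reach X t S \subset N.
Proof.
by move=> XN /setIidPl sS; apply/setIidPl; rewrite reach_setI // sS.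
Qed.

Lemma reach_restrict X t S N : edge_closed X N -> S \subset N ->
  reach X t S = reach (X :&: setX N N) t S.
Proof.
move=> XN sS; elim: t => //= t <-.
have sN := reach_sub t XN sS; move: (reach X t S) sN => A /subsetP sN.
apply/setP=> v; apply/reach_stepP/reach_stepP; (case; first by left);
  case=> u uA [Euv uvX]; right; exists u => //; split=> //.
  by rewrite !inE uvX -(XN _ _ uvX) sN.
by move: uvX; rewrite inE => /andP[].
Qed.

(** The right-hand side involves [q] only on pairs inside [N], so functions agreeing there can be
    compared. *)
Lemma marginal_restrict q N v S : v \in N ->
    (forall u w, (u \in N) != (w \in N) -> q u w = 0) ->
  marginal E q v S =
  \sum_(B in powerset (setX N N)) outcome_prob q (setX N N) B *
    #|reach B #|V| [set v] :\: reach B #|V| (S :&: N)|%:R.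
Proof.
move=> vN q0; rewrite marginal_reach.
pose g B : R := #|reach B #|V| [set v] :\: reach B #|V| (S :&: N)|%:R.
rewrite (@eq_expectation_support q _ (fun X => g (X :&: setX N N))).
  rewrite (@expectation_local q (setX N N)); last by move=> X; rewrite -setIA setIid.
  by apply: eq_bigr => B; rewrite inE => /setIidPl ->.
move=> X Xq; have XN : edge_closed X N.
  by move=> u w /Xq qX; apply/eqP; apply: contraNT qX => /q0 ->.
have sv : [set v] \subset N by rewrite sub1set.
rewrite /g -!reach_restrict ?subsetIr // -reach_setI //.
have /setIidPl sr := reach_sub #|V| XN sv.
congr (_%:R); apply: eq_card => x; rewrite !inE.
by move/setP/(_ x): sr; rewrite inE; case: (x \in N); rewrite ?andbT // andbF => <-;
   rewrite !andbF.
Qed.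

Lemma eq_marginal_restrict q1 q2 N v S : v \in N ->
    (forall u w, (u \in N) || (w \in N) -> q1 u w = q2 u w) ->
    (forall u w, (u \in N) != (w \in N) -> q1 u w = 0) ->
  marginal E q1 v S = marginal E q2 v (S :&: N).
Proof.
move=> vN q12 q0.
have q0' u w : (u \in N) != (w \in N) -> q2 u w = 0.
  by move=> uw; rewrite -q12 ?q0 //; case: (u \in N) uw => //; case: (w \in N).
rewrite !(marginal_restrict _ vN) // -setIA setIid; apply: eq_bigr => B.
rewrite inE => /subsetP sB; congr (_ * _); congr (_ * _); apply: eq_bigr => e.
  by move/sB; rewrite inE => /andP[eN _]; rewrite q12 ?eN.
by rewrite !inE => /and3P[_ eN _]; rewrite q12 ?eN.
Qed.

(** With probability 1 no live edge touches [v], which then reaches only itself and is not reached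
    from [S]. *)
Lemma marginal_isolated q v S :
  (forall u, q u v = 0 /\ q v u = 0) -> v \notin S -> marginal E q v S = 1.
Proof.
move=> q0 vS; rewrite marginal_reach -[RHS](expectation_cst q).
apply: eq_expectation_support => X Xq.
have XN : edge_closed X [set v].
  move=> u w /Xq /=; rewrite !inE; have [->|_] := eqVneq u v.
    by case: (q0 w) => _ ->; rewrite eqxx.
  by have [->|_] := eqVneq w v => //; case: (q0 u) => ->; rewrite eqxx.
have -> : reach X #|V| [set v] :\: reach X #|V| S = [set v]; last by rewrite cards1.
have rv : v \in reach X #|V| [set v].
  by elim: #|V| => [|t IH] /=; [rewrite inE | apply/reach_stepP; left].
have rS : v \notin reach X #|V| S.
  have : reach X #|V| S :&: [set v] = set0.
    rewrite reach_setI //; have -> : S :&: [set v] = set0.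
      by apply/setP=> x; rewrite !inE; case: eqP => [->|]; rewrite ?(negPf vS) ?andbF.
    elim: #|V| => //= t ->; apply/setP=> x; rewrite [RHS]in_set0; apply/reach_stepP.
    by case=> [|[u]]; rewrite inE.
  by move/setP/(_ v); rewrite !inE eqxx andbT => ->.
apply/eqP; rewrite eqEsubset sub1set in_setD rv rS andbT.
by rewrite (subset_trans (subsetDl _ _)) // reach_sub.
Qed.

End LiveEdge.

(** * Properties of a single greedy run *)

Section Greedy.

Variables (R : realFieldType) (V : finType) (E : rel V).
Variables (q : V -> V -> R) (k : nat) (s : k.-tuple V).
Hypothesis s_greedy : greedy_run E q s.

Lemma greedy_uniq : uniq s.
Proof.
case: k s s_greedy => [|k'] [s0 /= sz] gs; first by case: s0 sz {gs}.
have x0 : V by case: s0 sz {gs}.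
apply/negPn/negP => /(uniqPn x0)[i [j [ij js e]]].
have jk : (j < k'.+1)%N by rewrite -(eqP sz).
have [+ _] := gs (Ordinal jk); rewrite (tnth_nth x0) inE /= => /negP; apply.
by rewrite -e -(nth_take x0 ij) mem_nth // size_takel // ltnW.
Qed.

Lemma greedy_marginal_max v w :
    v \in s -> w \notin [set x in take (index v s) s] ->
  marginal E q w [set x in take (index v s) s] <= greedy_marginal E q s v.
Proof.
move=> vs ws; have jk : (index v s < k)%N.
  by rewrite -[X in (_ < X)%N](size_tuple s) index_mem.
have [_ /(_ w ws)] := s_greedy (Ordinal jk).
by rewrite (tnth_nth v) /= nth_index // /greedy_marginal vs.
Qed.

(** When [u] was selected, [v] was still available and offered no more than [u]; by submodularity
    its marginal cannot have grown since. *)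
Lemma greedy_marginal_nonincr u v :
    (forall x y, 0 <= q x y <= 1) -> v \in s -> (index u s <= index v s)%N ->
  greedy_marginal E q s v <= greedy_marginal E q s u.
Proof.
move=> q01 vs uv.
have us : u \in s by rewrite -index_mem (leq_ltn_trans uv) // index_mem.
have vNu : v \notin [set x in take (index u s) s].
  by rewrite inE in_take // -leqNgt.
apply: le_trans (greedy_marginal_max us vNu).
rewrite /greedy_marginal vs; apply: marginal_submodular => //.
apply/subsetP=> x; rewrite !inE => xu.
have xs := mem_take xu.
by move: xu; rewrite !in_take // => /leq_trans; apply.
Qed.

End Greedy.

(** * Topics, landmarks and sorting by score *)

Lemma topic_nodes_out (R : realFieldType) (V : finType) (E : rel V)
    (q : V -> V -> R) u w :
  influence_prob E q -> u \notin topic_nodes E q -> q u w = 0 /\ q w u = 0.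
Proof.
move=> [q01 qE]; have q0 x y : 0 <= q x y by case/andP: (q01 x y).
rewrite inE -leNgt => sum_le0.
have out0 : 0 <= \sum_(x | E u x) q u x by apply: sumr_ge0.
have in0 : 0 <= \sum_(x | E x u) q x u by apply: sumr_ge0.
have /eqP : \sum_(x | E u x) q u x + \sum_(x | E x u) q x u = 0.
  by apply/eqP; rewrite eq_le sum_le0 addr_ge0.
rewrite paddr_eq0 // !psumr_eq0 // => /andP[/allP out /allP inn]; split.
  have [Euw|Euw] := boolP (E u w); last by rewrite qE ?Euw.
  by have /implyP/(_ Euw)/eqP := out w (mem_index_enum w).
have [Ewu|Ewu] := boolP (E w u); last by rewrite qE ?Ewu.
by have /implyP/(_ Ewu)/eqP := inn w (mem_index_enum w).
Qed.

(** Makes the rounding in MIS trivial for the given item; [0 <= x] accounts for the default 0 of the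
    maximum. *)
Lemma lower_landmark_mem (R : realFieldType) (L : seq R) x :
  0 <= x -> x \in L -> lower_landmark L x = x.
Proof.
move=> x0 xL; apply/eqP; rewrite eq_le /lower_landmark.
by rewrite bigmax_le //=; apply: le_bigmax_seq.
Qed.

(** A lexicographic sort, by decreasing [f] and then increasing [rk]. The rank will be the position
    in a greedy run, so that ties respect the run. *)
Lemma exists_score_sort (R : realDomainType) (V : finType) (k : nat)
    (f : V -> R) (rk : V -> nat) (T : {set V}) : #|T| = k ->
  exists s : k.-tuple V, T = [set x in s] /\
    forall j : 'I_k, let v := tnth s j in let S := [set x in take j s] in
      [/\ v \in T, v \notin S, S \proper T,
       forall u, u \in S -> u != v /\ f v <= f u /\ (f u = f v -> (rk u <= rk v)%N) &
       forall w, w \in T -> w \notin S -> f w <= f v].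
Proof.
move=> cardT.
pose le u v := (f v < f u) || ((f u == f v) && (rk u <= rk v)%N).
have le_total : total le.
  by move=> u v; rewrite /le; case: ltgtP => //= _; apply: leq_total.
have le_tr : transitive le.
  move=> v u w /orP[uv|/andP[/eqP uv ruv]] /orP[vw|/andP[/eqP vw rvw]];
    rewrite /le.
  - by rewrite (lt_trans vw uv).
  - by rewrite -vw uv.
  - by rewrite uv vw.
  - by rewrite uv vw eqxx (leq_trans ruv rvw) orbT.
have le_f u v : le u v -> f v <= f u /\ (f u = f v -> (rk u <= rk v)%N).
  rewrite /le => /orP[fuv|/andP[/eqP -> ruv]]; last by rewrite lexx.
  by rewrite ltW //; split=> // e; rewrite e ltxx in fuv.
pose s0 := sort le (enum T).
have sz : size s0 == k by rewrite size_sort -cardE cardT.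
have Ts x : (x \in s0) = (x \in T) by rewrite mem_sort mem_enum.
exists (Tuple sz); split; first by apply/setP=> x; rewrite inE /= Ts.
move=> j v S.
have js : (j < size s0)%N by rewrite (eqP sz).
have vE : v = nth v s0 j by apply: tnth_nth.
have s0E : s0 = take j s0 ++ v :: drop j.+1 s0.
  by rewrite vE -drop_nth // cat_take_drop.
have : uniq s0 by rewrite sort_uniq enum_uniq.
have : pairwise le s0 by rewrite -sorted_pairwise // sort_sorted.
rewrite s0E pairwise_cat cat_uniq allrel_consr => /and3P[/andP[/allP le1 _] _ /=].
case/andP=> /allP le2 _ /and3P[_]; rewrite negb_or => /andP[vS _] _.
have ST : S \subset T by apply/subsetP=> x; rewrite inE -Ts; apply: mem_take.
have vT : v \in T by rewrite -Ts s0E mem_cat mem_head orbT.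
have vNS : v \notin S by rewrite inE.
split=> //.
- by apply/properP; split=> //; exists v.
- move=> u uS; split; first by apply: contraNneq vNS => <-.
  by apply: le_f; apply: le1; move: uS; rewrite inE.
- move=> w; rewrite -Ts s0E mem_cat inE => /orP[wS|/orP[/eqP -> //|/le2 /le_f[] //]].
  by rewrite inE wS.
Qed.

(** An endpoint in one topic's node set lies outside all the others, so a single summand of the
    mixture survives. *)
Lemma mixture_topic (R : realFieldType) (V : finType) (E : rel V) (d : nat)
    (p : 'I_d -> V -> V -> R) (lam : 'I_d -> R) (i : 'I_d) u w :
    (forall j, influence_prob E (p j)) -> fully_separable E p ->
    (u \in topic_nodes E (p i)) || (w \in topic_nodes E (p i)) ->
  mixture lam p u w = scale (lam i) (p i) u w.
Proof.
move=> p_prob sep uwN; rewrite /mixture (bigD1 i) //= big1 ?addr0 // => j ji.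
have dij : [disjoint topic_nodes E (p i) & topic_nodes E (p j)].
  by apply: sep; rewrite eq_sym.
case/orP: uwN => /(disjointFr dij)/negbT/(topic_nodes_out _ (p_prob j)).
  by move=> /(_ w)[-> _]; rewrite mulr0.
by move=> /(_ u)[_ ->]; rewrite mulr0.
Qed.

Lemma scale_itv (R : realFieldType) (V : finType) (a : R) (q : V -> V -> R) :
    0 <= a <= 1 -> (forall u w, 0 <= q u w <= 1) ->
  forall u w, 0 <= scale a q u w <= 1.
Proof.
move=> /andP[a0 a1] q01 u w; have /andP[q0 q1] := q01 u w.
by rewrite /scale mulr_ge0 //= mulr_ile1.
Qed.

(** * Greedy optimality of the sorted MIS output *)

Theorem theorem4p2 (R : realFieldType) (V : finType) (E : rel V)
    (d : nat) (d_gt0 : (0 < d)%N)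
    (p : 'I_d -> V -> V -> R) (p_prob : forall i, influence_prob E (p i))
    (k : nat) (k_bounds : (1 <= k <= #|V|)%N)
    (L : seq R) (L_landmarks : landmarks L)
    (run : R -> 'I_d -> k.-tuple V)
    (run_greedy : forall (a : R) (i : 'I_d), a \in L ->
       greedy_run E (scale a (p i)) (run a i))
    (lam : 'I_d -> R) (lam_item : item lam) (lam_L : forall i, lam i \in L)
    (seeds_disjoint : forall i j : 'I_d, i != j ->
       [disjoint seeds run (lam i) i & seeds run (lam j) j])
    (seeds_sub : forall i : 'I_d, 0 < lam i ->
       seeds run (lam i) i \subset topic_nodes E (p i))
    (separable : fully_separable E p)
    (T : {set V}) (T_mis : mis_output E p L run lam T) :
  exists s : k.-tuple V,
    T = [set x in s] /\ greedy_run E (mixture lam p) s.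
Proof.
have [lam01 _] := lam_item; have [sT cardT T_top] := T_mis.
have lam_low i : lower_landmark L (lam i) = lam i.
  by apply: lower_landmark_mem => //; case/andP: (lam01 i).
pose N i := topic_nodes E (p i); pose q i := scale (lam i) (p i).
pose r i := run (lam i) i.
have q01 i u w : 0 <= q i u w <= 1 by apply: scale_itv => //; case: (p_prob i).
have r_greedy i : greedy_run E (q i) (r i) by apply: run_greedy.
have rN i v : 0 < lam i -> v \in r i -> v \in N i.
  by move=> /seeds_sub/subsetP/(_ v); rewrite inE; apply.
have N_inj i j v : v \in N i -> v \in N j -> i = j.
  move=> vi vj; apply/eqP; apply: contraTT vj => ij.
  by rewrite (disjointFr (separable _ _ ij) vi).
pose f := mis_score E p L run lam.
have candP v : reflect (exists2 i, 0 < lam i & v \in r i)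
                       (v \in mis_candidates L run lam).
  apply: (iffP bigcupP) => -[i]; rewrite ?lam_low ?inE => lam_i vr; exists i => //.
    by rewrite lam_low.
  by rewrite lam_low inE.
(* By separability [v] occurs in the run of only one topic of positive weight, so the score has one
   nonzero term at most. *)
have fE i v : 0 < lam i -> v \in r i -> f v = greedy_marginal E (q i) (r i) v.
  move=> lam_i vr; rewrite /f /mis_score (bigD1 i) ?lam_low //= big1 ?addr0 //.
  move=> j; rewrite lam_low => /andP[lam_j ji]; rewrite /greedy_marginal ifF //.
  apply/negP => vj; move: ji; rewrite (N_inj j i v) ?eqxx //; exact: rN.
(* The picked topic is unique by [N_inj]; the default 0 concerns only nodes that are not
   candidates. *)
pose rk v := if [pick i | (0 < lam i) && (v \in r i)] is Some i
             then index v (r i) else 0%N.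
have rkE i v : 0 < lam i -> v \in r i -> rk v = index v (r i).
  move=> lam_i vr; rewrite /rk; case: pickP => [j /andP[lam_j vj]|/(_ i)].
    by rewrite (N_inj j i v) //; apply: rN.
  by rewrite lam_i vr.
have marg_mix i v S : v \in N i ->
    marginal E (mixture lam p) v S = marginal E (q i) v (S :&: N i).
  move=> vN; apply: eq_marginal_restrict => // u w uw.
    exact: (mixture_topic lam p_prob separable uw).
  have uw' : (u \in N i) || (w \in N i).
    by case: (u \in N i) uw => //; case: (w \in N i).
  rewrite (mixture_topic lam p_prob separable uw') /scale.
  case uN: (u \in N i) uw => /=.
    move=> /negbTE/negbT wN; have [_ ->] := topic_nodes_out u (p_prob i) wN.
    by rewrite mulr0.
  by have [-> _] := topic_nodes_out w (p_prob i) (negbT uN); rewrite mulr0.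
have [s [Ts sP]] := exists_score_sort f rk cardT.
exists s; split=> // j Sj; have := sP j; rewrite -/Sj.
set v := tnth s j => -[vT vS ST before after]; split=> // w wS.
have cand_of x : x \in T -> exists2 i, 0 < lam i & x \in r i.
  by move=> /(subsetP sT)/candP.
have [i lam_i vr] := cand_of v vT.
(* It suffices that the nodes of [Sj] in topic [i] all precede [v] in the run [r i]. *)
have f_le : f v <= marginal E (mixture lam p) v Sj.
  rewrite (marg_mix i) ?rN // (fE i) // /greedy_marginal vr.
  apply: marginal_submodular => //; apply/subsetP=> u /setIP[uS uN].
  have [i' lam_i' ur'] := cand_of u (subsetP (proper_sub ST) u uS).
  have ii' : i' = i by apply: N_inj uN; apply: rN.
  have ur : u \in r i by rewrite -ii'.
  have [uv [fuv rk_uv]] := before u uS.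
  (* If [u] did not precede [v] in the run, the scores would tie, and the tie-breaking rank would
     force equal positions, hence [u = v]. *)
  rewrite inE in_take // ltnNge; apply/negP => vu.
  have fvu : f u = f v.
    apply/eqP; rewrite eq_le fuv andbT !(fE i) //.
    exact: greedy_marginal_nonincr.
  have := rk_uv fvu; rewrite !(rkE i) // => uv_le.
  have /eqP e : index u (r i) == index v (r i) by rewrite eqn_leq uv_le.
  by move: uv; rewrite -(nth_index u ur) e nth_index ?eqxx.
apply: le_trans f_le.
(* Inside [T] this is the sorting order; outside [T] it is the choice made by MIS. *)
have f_ge x : x \in mis_candidates L run lam -> x \notin Sj -> f x <= f v.
  move=> xc xS; have [xT|xT] := boolP (x \in T); first exact: after.
  by apply: T_top => //; rewrite inE xT.
have [/existsP[m /andP[lam_m wN]]|no_topic] :=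
  boolP [exists m, (0 < lam m) && (w \in N m)].
  pose a := [pred x | x \notin Sj].
  (* The run has [k] distinct nodes, while [Sj], a proper subset of [T], has fewer. *)
  have has_a : has a (r m).
    apply/hasPn => rS.
    have sub : [set x in r m] \subset Sj.
      by apply/subsetP=> x; rewrite inE => /rS /=; rewrite negbK.
    have := leq_ltn_trans (subset_leq_card sub) (proper_card ST).
    by rewrite cardT cardsE (card_uniqP (greedy_uniq (r_greedy m))) size_tuple ltnn.
  pose x := nth w (r m) (find a (r m)).
  have xr : x \in r m by rewrite mem_nth // -has_find.
  have xS : x \notin Sj by have := nth_find w has_a.
  have xidx : index x (r m) = find a (r m).
    by rewrite index_uniq -?has_find // (greedy_uniq (r_greedy m)).
  have pre_sub : [set y in take (index x (r m)) (r m)] \subset Sj.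
    apply/subsetP=> y; rewrite inE => yt; have yr := mem_take yt.
    move: yt; rewrite in_take // xidx => /(before_find w).
    by rewrite nth_index //= => /negbFE.
  rewrite (marg_mix m) //; apply: le_trans (f_ge x _ xS); last by apply/candP; exists m.
  (* The run preferred [x] to [w] after the prefix before [x]; that prefix lies in [Sj :&: N m], so
     the marginal of [w] is now no larger. *)
  rewrite (fE m) //; apply: le_trans (greedy_marginal_max (r_greedy m) xr _).
    apply: marginal_submodular => //; apply/subsetP=> y yt.
    rewrite inE (subsetP pre_sub) // rN //.
    by move: yt; rewrite inE; apply: mem_take.
  by apply: contra wS; apply: (subsetP pre_sub).
have w_out m u : lam m * p m u w = 0 /\ lam m * p m w u = 0.
  have [->|lam_m] := eqVneq (lam m) 0; first by rewrite !mul0r.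
  have wN : w \notin N m.
    apply: contra no_topic => wN; apply/existsP; exists m.
    by rewrite wN andbT lt_def lam_m; case/andP: (lam01 m).
  by have [-> ->] := topic_nodes_out u (p_prob m) wN; rewrite mulr0.
have -> : marginal E (mixture lam p) w Sj = 1.
  apply: marginal_isolated => // u.
  by split; apply: big1 => m _; case: (w_out m u).
(* Being isolated for topic [i] and absent from its run, [w] offered marginal 1 when [v] was
   selected there, so [f v] is at least 1. *)
have wNi : w \notin N i.
  by apply: contra no_topic => wN; apply/existsP; exists i; rewrite lam_i.
have w_pre : w \notin [set x in take (index v (r i)) (r i)].
  by apply: contra wNi; rewrite inE => /mem_take; apply: rN.
rewrite (fE i) //; apply: le_trans (greedy_marginal_max (r_greedy i) vr w_pre).
by rewrite marginal_isolated // => u; apply: w_out.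
Qed.
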